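(* Let $(a_{i,j})_{n\times n}$ be the Cartan matrix of a simple Lie algebra of rank $n$. There exist a tuple of distinct points $p_1,\dots,p_m\in\mathbb{R}^2$ and numbers $\beta_{i,\ell}\in[0,1)$, $i=1,\dots,n$, $\ell=1,\dots,m$, satisfying $$\sum_{s=1,\ s\neq\ell}^m\beta_{i,s}>\max_{1\le k\le n}\beta_{k,\ell}\qquad\text{for every } i=1,\dots,n,\ \ell=1,\dots,m,$$ such that the system $$-\Delta u_i=\sum_{j=1}^n a_{i,j}K_je^{2u_j}\ \text{ in }\mathbb{R}^2,\qquad K_i(x):=\prod_{\ell=1}^m\frac{1}{|x-p_\ell|^{2\beta_{i,\ell}}},\qquad i=1,\dots,n,$$ has no continuous solution $(u_1,\dots,u_n)$ satisfying, for each $i=1,\dots,n$, $$u_i(x)=-\beta_i\log|x|+\text{a bounded continuous function on }\{x\in\mathbb{R}^2:|x|\ge1\},\qquad \beta_i:=2-\sum_{\ell=1}^m\beta_{i,\ell}.$$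
   Context: Solutions are continuous functions on $\mathbb{R}^2$ satisfying the equations in the sense of distributions (the functions $K_j$ may be singular at the points $p_\ell$). *)

(* Defs.v *)
From HB Require Import structures.
From mathcomp Require Import all_boot all_order all_algebra.
From mathcomp Require Import all_classical all_reals all_analysis.
From mathcomp Require Import complex.

Set Implicit Arguments.
Unset Strict Implicit.
Unset Printing Implicit Defensive.

Import Order.TTheory GRing.Theory Num.Theory.
Import numFieldNormedType.Exports.

Local Open Scope classical_set_scope.
Local Open Scope ring_scope.

Section LieAlgebras.
Variable F : fieldType.

(* Finite-dimensional Lie algebras over F. *)
Record lieAlgebra := LieAlgebra {
  lie_sort :> vectType F;
  lie_br : lie_sort -> lie_sort -> lie_sort;
  lie_brDl : forall y, linear (lie_br^~ y);
  lie_brDr : forall x, linear (lie_br x);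
  lie_brxx : forall x, lie_br x x = 0;
  lie_jacobi : forall x y z,
    lie_br x (lie_br y z) + lie_br y (lie_br z x) + lie_br z (lie_br x y) = 0
}.

Variable g : lieAlgebra.
Local Notation "[ 'L' x , y ]" := (lie_br x y) (format "[ 'L'  x ,  y ]").

Definition lie_ideal (I : {vspace g}) : Prop :=
  forall x y : g, y \in I -> [L x, y] \in I.

Definition simple_lie : Prop :=
  (exists x y : g, [L x, y] != 0) /\
  (forall I : {vspace g}, lie_ideal I -> I = 0%VS \/ I = fullv).

Definition lie_ad (x : g) : 'End(g) := linfun (lie_br x).

Definition killing (x y : g) : F :=
  \tr (passmx.mxof (vbasis {:g}) (vbasis {:g}) (lie_ad x \o lie_ad y)%VF).

(* ad x is diagonalizable, i.e. semisimple when F is algebraically closed. *)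
Definition ad_semisimple (x : g) : Prop :=
  exists2 X : seq g, basis_of {:g} X &
    forall v, v \in X -> exists c : F, [L x, v] = c *: v.

(* A commutative subalgebra of ad-semisimple elements that is its own
   centralizer. *)
Definition cartan_subalgebra (h : {vspace g}) : Prop :=
  [/\ forall x y, x \in h -> y \in h -> [L x, y] = 0,
      forall x, x \in h -> ad_semisimple x &
      forall x, (forall y, y \in h -> [L x, y] = 0) -> x \in h].

Definition lie_root (h : {vspace g}) (al : 'Hom(subvs_of h, F^o)) : Prop :=
  al != 0 /\
  exists2 x : g, x != 0 & forall y : subvs_of h, [L vsval y, x] = al y *: x.

(* A base of the root system.  The F-span of the roots is h^*, and a base of
   the root system in its real span is the same thing as an F-basis of h^*
   made of roots with the sign property below; in particular n is the rank
   \dim h. *)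
Definition root_base (h : {vspace g}) (n : nat)
    (al : n.-tuple 'Hom(subvs_of h, F^o)) : Prop :=
  [/\ forall i, lie_root (tnth al i),
      basis_of fullv al &
      forall be, lie_root be -> exists c : 'I_n -> nat,
        be = \sum_i (c i)%:R *: tnth al i \/
        be = - \sum_i (c i)%:R *: tnth al i].

(* a_ij = 2 (al_i, al_j) / (al_j, al_j) for the simple roots al_i, where the
   bilinear form on h^* is the transport (al_i, al_j) = killing t_i t_j of the
   Killing form, t_i being the element of h representing al_i.  The other
   common convention transposes the matrix, which amounts to replacing g by
   its dual (B_n <-> C_n), so the set of all Cartan matrices is the same. *)
Definition cartan_matrix_of (n : nat) (A : 'M[int]_n) : Prop :=
  exists (h : {vspace g}) (al : n.-tuple 'Hom(subvs_of h, F^o))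
         (t : 'I_n -> subvs_of h),
    [/\ cartan_subalgebra h,
        root_base al,
        forall i (y : subvs_of h),
          killing (vsval (t i)) (vsval y) = tnth al i y &
        forall i j, killing (vsval (t j)) (vsval (t j)) != 0 /\
          (A i j)%:~R = 2%:R * killing (vsval (t i)) (vsval (t j))
                        / killing (vsval (t j)) (vsval (t j))].

End LieAlgebras.

Section Plane.
Variable R : realType.
Local Notation R2 := (R * R)%type.

(* Not the library norm of R * R, which is the max norm. *)
Definition enorm (x : R2) : R := Num.sqrt (x.1 ^+ 2 + x.2 ^+ 2).

Definition leb2 :
    {measure set (measurableTypeR R * measurableTypeR R) -> \bar R} :=
  (@lebesgue_measure R \x @lebesgue_measure R)%E.

Definition e1 : R2 := (1, 0).
Definition e2 : R2 := (0, 1).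

Definition laplacian (f : R2 -> R) (x : R2) : R :=
  'D_e1 ('D_e1 f) x + 'D_e2 ('D_e2 f) x.

Fixpoint class_C (k : nat) (f : R2 -> R) : Prop :=
  continuous f /\
  if k is k'.+1 then
    [/\ forall x, derivable f x e1 /\ derivable f x e2,
        class_C k' ('D_e1 f) & class_C k' ('D_e2 f)]
  else True.

Definition test_function (phi : R2 -> R) : Prop :=
  (forall k, class_C k phi) /\ compact (closure [set x | phi x != 0]).

(* The one-dimensional library notion [locally_integrable], on the plane. *)
Definition locally_integrable2 (f : R2 -> R) : Prop :=
  measurable_fun setT f /\
  forall K : set R2, compact K -> (\int[leb2]_(x in K) `|f x|%:E < +oo)%E.

(* -Delta u = f as distributions on the plane; both sides must be locally
   integrable to define distributions by integration. *)
Definition poisson_distr (u f : R2 -> R) : Prop :=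
  [/\ locally_integrable2 u, locally_integrable2 f &
      forall phi, test_function phi ->
        \int[leb2]_x (u x * - laplacian phi x) =
        \int[leb2]_x (f x * phi x)].

Section Toda.
Variables (n m : nat) (p : 'I_m -> R2) (b : 'I_n -> 'I_m -> R).

(* At the points p l with b i l > 0 the value is the junk value 1 / 0 = 0; only
   the class of Kfun up to null sets is used. *)
Definition Kfun (i : 'I_n) (x : R2) : R :=
  \prod_(l < m) (1 / enorm (x - p l) `^ (2 * b i l)).

Definition toda_solution (A : 'M[int]_n) (u : 'I_n -> R2 -> R) : Prop :=
  forall i, continuous (u i) /\
    poisson_distr (u i)
      (fun x => \sum_(j < n) (A i j)%:~R * Kfun j x * expR (2 * u j x)).

Definition beta_inf (i : 'I_n) : R := 2 - \sum_(l < m) b i l.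

Definition toda_asymptotics (u : 'I_n -> R2 -> R) : Prop :=
  forall i, exists w : R2 -> R,
    [/\ {within [set x | 1 <= enorm x], continuous w},
        exists M : R, forall x, 1 <= enorm x -> `|w x| <= M &
        forall x, 1 <= enorm x -> u i x = - beta_inf i * ln (enorm x) + w x].

End Toda.
End Plane.

(* Main.v *)
Require Import Defs.
From HB Require Import structures.
From mathcomp Require Import all_boot all_order all_algebra.
From mathcomp Require Import all_classical all_reals all_analysis.
From mathcomp Require Import measurable_realfun complex ring lra.

(** The parameters can be chosen so that a linear combination of the u_i would be
    a continuous superharmonic function on the plane that tends to infinity at
    infinity, and there is none.

    The combination.  As n > 0 ([cartan_rank_gt0]), there are real numbers c_i, not
    all zero, with sum_i c_i a_ij >= 0 for all j ([exists_nonneg_combination]).  For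
    any solution u, the function v = sum_i c_i u_i then satisfies
    - Delta v = sum_j (sum_i c_i a_ij) K_j exp(2 u_j) >= 0 in the sense of
    distributions ([poisson_lincomb_superharmonic]), and v is equal to
    - (sum_i c_i beta_i) ln |x| up to a bounded function.  With four points and
    beta_(i,l) depending on i only, the hypotheses on the beta_(i,l) leave room for
    beta_i of either sign; giving beta_i the sign opposite to that of c_i, when c_i is
    nonzero, makes v tend to infinity ([toda_lincomb_coercive]).

    The contradiction ([superharmonic_not_coercive]).  Let h(r) = exp(-1/r) for r > 0
    and h(r) = 0 otherwise.  For t > 0, the function phi_t(x) = h(1 - t |x|^2) is a
    test function, and k_t(x) = t h'(1 - t |x|^2) satisfies
    - Delta phi_t = 4 t (d/dt) k_t ([laplacian_bump], [is_derive_scaled_bump]).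
    As v is superharmonic, the integral of v k_t is therefore nondecreasing in t
    ([bump_average_ndecr]).  But when t decreases to 0, k_t spreads a fixed mass over
    larger and larger disks, so that this integral tends to infinity with v
    ([bump_average_ge]). *)

Set Implicit Arguments.
Unset Strict Implicit.
Unset Printing Implicit Defensive.

Import Order.TTheory GRing.Theory Num.Theory.
Import numFieldNormedType.Exports.

Local Open Scope classical_set_scope.
Local Open Scope ring_scope.

(** * Flat functions of one variable *)

Section ChainRule.
Variables (R : realType) (V : normedModType R).

Lemma is_derive_comp_real (f : V -> R) (g : R -> R) (x v : V) (df dg : R) :
  differentiable f x -> is_derive x v f df -> is_derive (f x) 1 g dg ->
  is_derive x v (g \o f) (df * dg).
Proof.
move=> fx [_ <-] [/derivable1_diffP gfx <-].
apply: DeriveDef; first exact/diff_derivable/differentiable_comp.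
rewrite !deriveE//; last exact: differentiable_comp.
by rewrite diff_comp//= -[X in 'd g _ X]mulr1 linearZ.
Qed.

End ChainRule.

Section Flat.
Variable R : realType.
Implicit Types (q : {poly R}) (r : R).

(** The functions q(1/r) exp(-1/r), extended by 0 to r <= 0.  Taken together over
    all polynomials q they are closed under differentiation, which makes the
    smoothness of each of them a formality. *)
Definition flat q r : R := if 0 < r then q.[r^-1] * expR (- r^-1) else 0.

(** For r > 0, the derivative of q(1/r) exp(-1/r) is
    r^-2 (q(1/r) - q'(1/r)) exp(-1/r). *)
Definition flat_deriv q : {poly R} := 'X^2 * (q - q^`()).

Lemma flat_npos q r : r <= 0 -> flat q r = 0.
Proof. by rewrite /flat leNgt => /negbTE ->. Qed.

Lemma expR_beats_monomial k (y : R) : 0 <= y -> y ^+ k * expR (- y) <= k`!%:R.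
Proof.
move=> y0; rewrite expRN ler_pdivrMr ?expR_gt0//.
case: k => [|k]; first by rewrite expr0 fact0 mul1r -expR0 ler_expR.
rewrite mulrC -ler_pdivrMr ?ltr0n ?fact_gt0//.
by apply: le_trans (expR_ge1Dxn k y0); rewrite lerDr.
Qed.

(** Each monomial y ^+ k of q, at y = 1/r, costs at most k! against exp(-y). *)
Lemma flat_bounded q : exists M, forall r, `|flat q r| <= M.
Proof.
exists (\sum_(i < size q) `|q`_i| * i`!%:R) => r.
rewrite /flat; case: ifP => r0; last by rewrite normr0 sumr_ge0.
rewrite horner_coef mulr_suml (le_trans (ler_norm_sum _ _ _))//.
apply: ler_sum => i _; rewrite -mulrA normrM ler_wpM2l//.
rewrite ger0_norm; first by apply: expR_beats_monomial; rewrite invr_ge0 ltW.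
by rewrite mulr_ge0 ?exprn_ge0 ?invr_ge0 ?expR_ge0 ?(ltW r0).
Qed.

(** Peeling off r ^+ 2 leaves a flat function, which is bounded: this is how the
    difference quotient of a flat function at the origin is seen to vanish. *)
Lemma flat_factor q r : flat q r = r ^+ 2 * flat ('X^2 * q) r.
Proof.
rewrite /flat; case: ifP => r0; last by rewrite mulr0.
have r2 : r ^+ 2 * r^-1 ^+ 2 = 1.
  by rewrite -exprMn divff ?expr1n// gt_eqF.
by rewrite hornerM hornerXn -(mulrA (r^-1 ^+ 2)) [RHS]mulrA r2 mul1r.
Qed.

Lemma is_derive_flat q r : is_derive r 1 (flat q) (flat (flat_deriv q) r).
Proof.
have [r0|r0|->] := ltgtP r 0.
- rewrite flat_npos ?ltW//.
  apply: (@near_eq_is_derive _ _ _ (cst 0)).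
  by near=> s; rewrite flat_npos// ltW//; near: s; exact: lt_nbhsl.
- have dV : is_derive r 1 (fun s : R => s^-1) (- r ^- 2).
    have r1 : r != 0 by rewrite gt_eqF.
    have d1 := is_deriveV r1 (is_derive_id r (1 : R)).
    by apply: is_derive_eq d1 _; rewrite [LHS]mulr1.
  have dfV : differentiable (fun s : R => s^-1) r.
    by apply/derivable1_diffP; case: dV.
  have dq := is_derive_comp_real dfV dV (is_derive_poly q r^-1).
  have dE : is_derive r 1 (expR \o (fun s : R => - s^-1))
      (r ^- 2 * expR (- r^-1)).
    apply: is_derive_comp_real; first exact: differentiableN.
    by rewrite -[r ^- 2]opprK; exact: is_deriveN.
  apply: near_eq_is_derive (is_derive_eq (is_deriveM dq dE) _).
    by near=> s; rewrite /flat ifT//; near: s; exact: lt_nbhsr.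
  by rewrite /flat r0 !hornerE/= /GRing.scale/= exprVn; ring.
- rewrite flat_npos//.
  have [M hM] := flat_bounded ('X^2 * q).
  have d0 : h^-1 *: ((flat q \o shift 0) (h *: (1:R)) - flat q 0)
      @[h --> (0:R)^'] --> (0 : R).
    apply/cvgr0Pnorm_lt => e e0.
    have M0 : 0 < `|M| + 1 by rewrite ltr_wpDl.
    near=> h.
    have h0 : h != 0 by near: h; exact: nbhs_dnbhs_neq.
    have he : `|h| < e / (`|M| + 1).
      near: h; apply: dnbhs0_lt; exact: divr_gt0.
    rewrite /= [X in flat q X](_ : _ = h); last by rewrite addr0 [LHS]mulr1.
    rewrite (@flat_npos q 0)// subr0 flat_factor [_ *: _](_ : _ =
      h * flat ('X^2 * q) h); last by rewrite /GRing.scale/=; field.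
    rewrite normrM.
    apply: (@le_lt_trans _ _ (`|h| * (`|M| + 1))).
      rewrite ler_wpM2l// (le_trans (hM _))// (le_trans (ler_norm _))//.
      by rewrite lerDl.
    by rewrite -ltr_pdivlMr.
  apply: DeriveDef; first by apply/cvg_ex; exists 0.
  exact: cvg_lim d0.
Unshelve. all: end_near. Qed.

Lemma continuous_flat q : continuous (flat q).
Proof.
move=> r; apply: differentiable_continuous; apply/derivable1_diffP.
by case: (is_derive_flat q r).
Qed.

End Flat.


(** * Radial test functions on the plane *)

Section PlaneCalculus.
Variable R : realType.
Local Notation R2 := (R * R)%type.

Definition sqnorm (x : R2) : R := x.1 ^+ 2 + x.2 ^+ 2.

Lemma differentiable_fst (x : R2) : differentiable (fst : R2 -> R) x.
Proof. by apply: (@linear_differentiable _ _ _ fst) => ?; exact: cvg_fst. Qed.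

Lemma differentiable_snd (x : R2) : differentiable (snd : R2 -> R) x.
Proof. by apply: (@linear_differentiable _ _ _ snd) => ?; exact: cvg_snd. Qed.

Lemma is_derive_fst (x v : R2) : is_derive x v (fst : R2 -> R) v.1.
Proof.
apply: DeriveDef; first exact/diff_derivable/differentiable_fst.
rewrite deriveE; last exact: differentiable_fst.
by rewrite (@diff_lin _ _ _ fst)// => ?; exact: cvg_fst.
Qed.

Lemma is_derive_snd (x v : R2) : is_derive x v (snd : R2 -> R) v.2.
Proof.
apply: DeriveDef; first exact/diff_derivable/differentiable_snd.
rewrite deriveE; last exact: differentiable_snd.
by rewrite (@diff_lin _ _ _ snd)// => ?; exact: cvg_snd.
Qed.

Lemma differentiable_sqnorm x : differentiable sqnorm x.
Proof.
have d1 := differentiableX 1 (differentiable_fst x).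
have d2 := differentiableX 1 (differentiable_snd x).
exact: differentiableD d1 d2.
Qed.

Lemma is_derive_sqnorm (x v : R2) :
  is_derive x v sqnorm (2 * (x.1 * v.1 + x.2 * v.2)).
Proof.
have d1 := is_deriveX 2 (is_derive_fst x v).
have d2 := is_deriveX 2 (is_derive_snd x v).
apply: is_derive_eq (is_deriveD d1 d2) _.
by rewrite /GRing.scale/= !expr1; ring.
Qed.

(* [class_C] is defined through iterated directional derivatives; the next
   lemmas make it stable under the ring operations. *)

Lemma class_C_cts k (f : R2 -> R) : class_C k f -> continuous f.
Proof. by case: k => [|k] []. Qed.

Lemma class_CW k (f : R2 -> R) : class_C k.+1 f -> class_C k f.
Proof.
elim: k f => [|k IH] f; first by case.
by move=> [cf [df /IH f1 /IH f2]]; split.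
Qed.

Lemma class_C_cst k (c : R) : class_C k (fun _ : R2 => c).
Proof.
elim: k c => [|k IH] c; split => //; try by move=> ?; exact: cvg_cst.
have D0 v : 'D_v (fun _ : R2 => c) = fun=> 0.
  by apply/funext => x; exact: derive_cst.
by split; [move=> x; split; exact: derivable_cst| |]; rewrite D0; exact: IH.
Qed.

Lemma class_CD k (f g : R2 -> R) :
  class_C k f -> class_C k g -> class_C k (fun x => f x + g x).
Proof.
elim: k f g => [|k IH] f g [cf df] [cg dg]; split => //.
- by move=> x; exact: cvgD (cf x) (cg x).
- by move=> x; exact: cvgD (cf x) (cg x).
move: df dg => [df f1 f2] [dg g1 g2]; split.
- move=> x; have [[? ?] [? ?]] := (df x, dg x).
  by split; exact: derivableD.
- rewrite (_ : 'D_(e1 R) _ = fun x => 'D_(e1 R) f x + 'D_(e1 R) g x);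
    first exact: IH.
  by apply/funext => x; have [[? ?] [? ?]] := (df x, dg x); exact: deriveD.
- rewrite (_ : 'D_(e2 R) _ = fun x => 'D_(e2 R) f x + 'D_(e2 R) g x);
    first exact: IH.
  by apply/funext => x; have [[? ?] [? ?]] := (df x, dg x); exact: deriveD.
Qed.

Lemma class_CM k (f g : R2 -> R) :
  class_C k f -> class_C k g -> class_C k (fun x => f x * g x).
Proof.
elim: k f g => [|k IH] f g fk gk.
  split=> // x; by apply: cvgM; [exact: (class_C_cts fk)|exact: (class_C_cts gk)].
split.
  by move=> x; apply: cvgM; [exact: (class_C_cts fk)|exact: (class_C_cts gk)].
have [fk' gk'] := (class_CW fk, class_CW gk).
move: fk gk => [_ [df f1 f2]] [_ [dg g1 g2]]; split.
- move=> x; have [[fx1 fx2] [gx1 gx2]] := (df x, dg x).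
  by split; [exact: (derivableM fx1 gx1)|exact: (derivableM fx2 gx2)].
- rewrite (_ : 'D_(e1 R) _ = fun x => f x * 'D_(e1 R) g x + g x * 'D_(e1 R) f x).
    by apply: class_CD; exact: IH.
  apply/funext => x; have [[fx1 fx2] [gx1 gx2]] := (df x, dg x).
  exact: (deriveM fx1 gx1).
- rewrite (_ : 'D_(e2 R) _ = fun x => f x * 'D_(e2 R) g x + g x * 'D_(e2 R) f x).
    by apply: class_CD; exact: IH.
  apply/funext => x; have [[fx1 fx2] [gx1 gx2]] := (df x, dg x).
  exact: (deriveM fx2 gx2).
Qed.

Lemma class_C_fst k : class_C k (fst : R2 -> R).
Proof.
case: k => [|k]; split => //; try by move=> x; exact: cvg_fst.
split=> [x||].
- by split; [case: (is_derive_fst x (e1 R))|case: (is_derive_fst x (e2 R))].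
- rewrite (_ : 'D_(e1 R) _ = fun=> (1 : R)); first exact: class_C_cst.
  by apply/funext => x; case: (is_derive_fst x (e1 R)).
- rewrite (_ : 'D_(e2 R) _ = fun=> (0 : R)); first exact: class_C_cst.
  by apply/funext => x; case: (is_derive_fst x (e2 R)).
Qed.

Lemma class_C_snd k : class_C k (snd : R2 -> R).
Proof.
case: k => [|k]; split => //; try by move=> x; exact: cvg_snd.
split=> [x||].
- by split; [case: (is_derive_snd x (e1 R))|case: (is_derive_snd x (e2 R))].
- rewrite (_ : 'D_(e1 R) _ = fun=> (0 : R)); first exact: class_C_cst.
  by apply/funext => x; case: (is_derive_snd x (e1 R)).
- rewrite (_ : 'D_(e2 R) _ = fun=> (1 : R)); first exact: class_C_cst.
  by apply/funext => x; case: (is_derive_snd x (e2 R)).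
Qed.

(** A radial function supported in the disk of radius t ^- 1/2.  The radius
    enters through t so that dilating is an affine change of the argument. *)
Definition plane_bump (t : R) (q : {poly R}) (x : R2) : R :=
  flat q (1 - t * sqnorm x).

Lemma is_derive_bump t q (x v : R2) :
  is_derive x v (plane_bump t q)
    (- (2 * t) * (x.1 * v.1 + x.2 * v.2) * plane_bump t (flat_deriv q) x).
Proof.
have dN : differentiable (cst 1 - t *: sqnorm) x.
  exact/differentiableB/differentiableZ/differentiable_sqnorm/differentiable_cst.
have iN := is_deriveB (is_derive_cst (1 : R) x v)
  (is_deriveZ t (is_derive_sqnorm x v)).
apply: is_derive_eq (is_derive_comp_real dN iN (is_derive_flat q _)) _.
rewrite /plane_bump [flat _ ((_ - _) x)]/(flat _ (1 - t * sqnorm x)).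
by rewrite /GRing.scale/=; ring.
Qed.

Lemma derive_bump1 t q :
  'D_(e1 R) (plane_bump t q) =
  fun x => - (2 * t) * x.1 * plane_bump t (flat_deriv q) x.
Proof.
apply/funext => x; case: (is_derive_bump t q x (e1 R)) => _ ->.
by rewrite /= mulr1 mulr0 addr0.
Qed.

Lemma derive_bump2 t q :
  'D_(e2 R) (plane_bump t q) =
  fun x => - (2 * t) * x.2 * plane_bump t (flat_deriv q) x.
Proof.
apply/funext => x; case: (is_derive_bump t q x (e2 R)) => _ ->.
by rewrite /= mulr1 mulr0 add0r.
Qed.

Lemma continuous_bump t q : continuous (plane_bump t q).
Proof.
move=> x; apply: (@continuous_comp _ _ _ (cst 1 - t *: sqnorm) (flat q)).
  apply: differentiable_continuous.
  exact/differentiableB/differentiableZ/differentiable_sqnorm/differentiable_cst.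
exact: continuous_flat.
Qed.

(** A derivative of a bump is a coordinate times a bump with another polynomial,
    so the induction must range over all q. *)
Lemma class_C_bump k t q : class_C k (plane_bump t q).
Proof.
elim: k q => [|k IH] q; split => //; try exact: continuous_bump.
split.
- move=> x; split; first by case: (is_derive_bump t q x (e1 R)).
  by case: (is_derive_bump t q x (e2 R)).
- rewrite derive_bump1; apply: class_CM => //.
  by apply: class_CM; [exact: class_C_cst|exact: class_C_fst].
- rewrite derive_bump2; apply: class_CM => //.
  by apply: class_CM; [exact: class_C_cst|exact: class_C_snd].
Qed.

(** With s = sqnorm x and L(s) = flat q (1 - t s), this is 4 (s L'(s))'. *)
Lemma laplacian_bump t q x : laplacian (plane_bump t q) x =
  - (4 * t) * (plane_bump t (flat_deriv q) x
               - t * sqnorm x * plane_bump t (flat_deriv (flat_deriv q)) x).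
Proof.
have d1 := is_deriveM (is_deriveZ (- (2 * t)) (is_derive_fst x (e1 R)))
  (is_derive_bump t (flat_deriv q) x (e1 R)).
have d2 := is_deriveM (is_deriveZ (- (2 * t)) (is_derive_snd x (e2 R)))
  (is_derive_bump t (flat_deriv q) x (e2 R)).
have -> : laplacian (plane_bump t q) x =
    'D_(e1 R) (fun y => - (2 * t) * y.1 * plane_bump t (flat_deriv q) y) x +
    'D_(e2 R) (fun y => - (2 * t) * y.2 * plane_bump t (flat_deriv q) y) x.
  by rewrite -derive_bump1 -derive_bump2.
move: d1 d2 => [_ d1] [_ d2].
rewrite [X in X + _](etrans _ d1)// [X in _ + X](etrans _ d2)//.
rewrite /sqnorm /GRing.scale/= -[_ *: x.1]/(- (2 * t) * x.1).
by rewrite -[_ *: x.2]/(- (2 * t) * x.2); ring.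
Qed.

Definition box (s : R) : set R2 := `[- s, s] `*` `[- s, s].

Lemma compact_box s : compact (box s).
Proof. by apply: compact_setX; exact: segment_compact. Qed.

Lemma bump_out s t q x : 0 < t -> 1 <= t * s ^+ 2 -> 0 <= s ->
  ~ box s x -> plane_bump t q x = 0.
Proof.
move=> t0 ts s0 nx; apply: flat_npos; rewrite subr_le0 (le_trans ts)//.
rewrite ler_wpM2l ?(ltW t0)//.
rewrite leNgt; apply/negP => xs; apply: nx; rewrite /box/= !in_itv/= -!ler_norml.
have sq y : y ^+ 2 <= s ^+ 2 -> `|y| <= s.
  by move=> ys; rewrite -(@ler_pXn2r _ 2) ?nnegrE// real_normK ?num_real.
by split; apply: sq; rewrite (le_trans _ (ltW xs))// ?lerDl ?lerDr ?sqr_ge0.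
Qed.

Lemma test_function_bump t q : 0 < t -> test_function (plane_bump t q).
Proof.
move=> t0; split=> [k|]; first exact: class_C_bump.
have cb := @compact_box (1 + t^-1).
apply: (subclosed_compact _ cb); first exact: closed_closure.
have clb : closed (box (1 + t^-1)).
  by apply: compact_closed => //; exact: norm_hausdorff.
rewrite [X in _ `<=` X](closure_id _).1//; apply: closureS => x /= /eqP bx.
apply: contrapT => nx; apply: bx; apply: bump_out nx => //.
  have := divff (lt0r_neq0 t0); have : 0 < t^-1 by rewrite invr_gt0.
  set y := t^-1; nra.
by rewrite addr_ge0// invr_ge0 ltW.
Qed.

End PlaneCalculus.


(** * Bump averages and superharmonicity *)

Section Superharmonic.
Variable R : realType.
Local Notation R2 := (R * R)%type.
Local Notation T2 := (measurableTypeR R * measurableTypeR R)%type.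
Local Notation mu := (@leb2 R).

Lemma measurable_box (s : R) : measurable (box s : set T2).
Proof. exact: measurableX. Qed.

Lemma measurable_sqnorm : measurable_fun [set: T2] (@sqnorm R).
Proof.
apply: measurable_funD; apply: measurable_funX.
  exact: measurable_fst.
exact: measurable_snd.
Qed.

Lemma measurable_bump (t : R) q : measurable_fun [set: T2] (plane_bump t q).
Proof.
have mf : measurable_fun setT (flat q).
  by apply: continuous_measurable_fun; exact: continuous_flat.
have mN : measurable_fun [set: T2] (fun x => 1 - t * @sqnorm R x).
  by apply: measurable_funB => //; apply: measurable_funM => //;
    exact: measurable_sqnorm.
exact: measurableT_comp mf mN.
Qed.

(** Weaker than [locally_integrable2], and visibly stable under linear
    combinations since boxes, unlike arbitrary compact sets, are plainly
    measurable. *)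
Definition box_integrable (u : R2 -> R) :=
  forall s, mu.-integrable (box s) (EFin \o u).

Lemma locally_integrable2_box (u : R2 -> R) :
  locally_integrable2 u -> box_integrable u.
Proof.
move=> [mu_ iu] s; apply/integrableP; split; last exact/iu/compact_box.
by apply/measurable_EFinP; exact: measurable_funTS.
Qed.

Lemma integrable_mul_supp (u w : R2 -> R) s M : box_integrable u ->
  measurable_fun [set: T2] w -> (forall x, `|w x| <= M) ->
  (forall x, ~ box s x -> w x = 0) ->
  mu.-integrable setT (EFin \o (fun x => u x * w x)).
Proof.
move=> iu mw wM w0.
have mB := measurable_box s.
have iuw : mu.-integrable (box s) (EFin \o (fun x => u x * w x)).
  apply: (@integrableMl _ _ _ mu _ mB (EFin \o u) w (iu s)).
    exact: measurable_funTS.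
  exists M; split; first exact: num_real.
  by move=> y My x xb; rewrite /= (le_trans (wM x))// ltW.
rewrite (_ : EFin \o _ = (EFin \o (fun x => u x * w x)) \_ (box s)).
  exact ((integrable_mkcond _ mB).1 iuw).
apply/funext => x; rewrite patchE; case: ifPn => // /negP nb /=.
by rewrite w0 ?mulr0// => bx; apply: nb; exact: mem_set.
Qed.

(** The derivative in t of t * plane_bump t q x.  For q = flat_deriv q0, it is also
    the Laplacian of plane_bump t q0 divided by - 4 t: compare
    [is_derive_scaled_bump] and [laplacian_bump]. *)
Definition scale_deriv (t : R) q (x : R2) : R :=
  plane_bump t q x - t * sqnorm x * plane_bump t (flat_deriv q) x.

Lemma is_derive_scaled_bump (t : R) q (x : R2) :
  is_derive t 1 (fun s : R => s * plane_bump s q x) (scale_deriv t q x).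
Proof.
have dN : differentiable (cst 1 - sqnorm x *: (@id R)) t.
  by apply: differentiableB => //; exact: differentiableZ.
have iN := is_deriveB (is_derive_cst (1 : R) t (1 : R))
  (is_deriveZ (sqnorm x) (is_derive_id t (1 : R))).
have ib := is_derive_comp_real dN iN (is_derive_flat q _).
have E : flat q \o (cst 1 - sqnorm x *: (@id R)) = fun s => plane_bump s q x.
  by apply/funext => s; rewrite /plane_bump mulrC.
have Et : (cst 1 - sqnorm x *: (@id R)) t = 1 - t * sqnorm x by rewrite mulrC.
rewrite E Et in ib.
apply: is_derive_eq (is_deriveM (is_derive_id t (1 : R)) ib) _.
by rewrite /scale_deriv /plane_bump /GRing.scale/=; ring.
Qed.

Lemma sqnorm_ge0 (x : R2) : 0 <= sqnorm x.
Proof. by rewrite addr_ge0 ?sqr_ge0. Qed.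

(** The bound is uniform in t because t * sqnorm x <= 1 on the support. *)
Lemma scale_deriv_bounded q :
  exists M : R, forall (t : R) x, 0 < t -> `|scale_deriv t q x| <= M.
Proof.
have [M1 h1] := flat_bounded q; have [M2 h2] := flat_bounded (flat_deriv q).
exists (M1 + M2) => t x t0; rewrite (le_trans (ler_normB _ _))//.
apply: lerD; first exact: h1.
have tN0 : 0 <= t * sqnorm x by rewrite mulr_ge0 ?sqnorm_ge0// ltW.
have [tN|tN] := leP (t * sqnorm x) 1; last first.
  have -> : plane_bump t (flat_deriv q) x = 0.
    by rewrite /plane_bump flat_npos ?subr_le0 ?ltW.
  by rewrite mulr0 normr0 (le_trans _ (h2 0)).
rewrite normrM (le_trans _ (h2 (1 - t * sqnorm x)))//.
by rewrite ler_piMl// ger0_norm.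
Qed.

Lemma scale_deriv_out s t q x : 0 < t -> 1 <= t * s ^+ 2 -> 0 <= s ->
  ~ box s x -> scale_deriv t q x = 0.
Proof.
by move=> t0 ts s0 nx; rewrite /scale_deriv !(bump_out _ t0 ts s0 nx) mulr0 subrr.
Qed.

Lemma measurable_scale_deriv t q : measurable_fun [set: T2] (scale_deriv t q).
Proof.
apply: measurable_funB; first exact: measurable_bump.
apply: measurable_funM; last exact: measurable_bump.
by apply: measurable_funM => //; exact: measurable_sqnorm.
Qed.

(** 1 + a^-1 is a square-root-free radius that contains the supports of all
    bumps of parameter t >= a. *)
Lemma box_radius_bound (a t : R) : 0 < a -> a <= t -> 1 <= t * (1 + a^-1) ^+ 2.
Proof.
move=> a0 at_; have := divff (lt0r_neq0 a0); have : 0 < a^-1 by rewrite invr_gt0.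
set y := a^-1 => y0 ay; apply: (@le_trans _ _ (a * (1 + y) ^+ 2)).
  by nra.
by rewrite ler_wpM2r ?sqr_ge0.
Qed.

Lemma integrable_bump (v : R2 -> R) t q : box_integrable v -> 0 < t ->
  mu.-integrable setT (EFin \o (fun x => v x * plane_bump t q x)).
Proof.
move=> iv t0; have [M hM] := flat_bounded q.
apply: (@integrable_mul_supp _ _ (1 + t^-1) M) => //.
- exact: measurable_bump.
- by move=> x; exact: hM.
- move=> x; apply: bump_out => //; first exact: box_radius_bound.
  by rewrite addr_ge0// invr_ge0 ltW.
Qed.

Lemma integrable_scale_deriv (v : R2 -> R) t q : box_integrable v -> 0 < t ->
  mu.-integrable setT (EFin \o (fun x => v x * scale_deriv t q x)).
Proof.
move=> iv t0; have [M hM] := scale_deriv_bounded q.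
apply: (@integrable_mul_supp _ _ (1 + t^-1) M) => //.
- exact: measurable_scale_deriv.
- by move=> x; exact: hM.
- move=> x; apply: scale_deriv_out => //; first exact: box_radius_bound.
  by rewrite addr_ge0// invr_ge0 ltW.
Qed.

(** The integral of v against a bump whose total mass does not depend on t; as t
    decreases the bump spreads over disks of radius t ^- 1/2. *)
Definition bump_average (v : R2 -> R) q (t : R) : R :=
  \int[mu]_x (v x * (t * plane_bump t q x)).

(** Differentiation under the integral sign: for parameters in ]t/2, t+1[ all
    integrands live in one box, where they are dominated by a multiple of |v|. *)
Lemma is_derive_bump_average (v : R2 -> R) q (t : R) : box_integrable v -> 0 < t ->
  is_derive t 1 (bump_average v q) (\int[mu]_x (v x * scale_deriv t q x)).
Proof.
move=> iv t0; have [M hM] := scale_deriv_bounded q.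
have a0 : 0 < t / 2 by rewrite divr_gt0.
pose s := 1 + (t / 2)^-1.
have s0 : 0 <= s by rewrite addr_ge0// invr_ge0 ltW.
have It : `]t / 2, t + 1[%classic t.
  by rewrite /= in_itv/= ltrDl ltr01 andbT ltr_pdivrMr// ltr_pMr// ltr1n.
have dk (x : R) y :
    is_derive x 1 (fun r : R => v y * (r * plane_bump r q y)) (v y * scale_deriv x q y).
  exact: (is_deriveZ (v y) (is_derive_scaled_bump x q y)).
have I1 x : `]t / 2, t + 1[%classic x ->
    mu.-integrable setT (EFin \o (fun y => v y * (x * plane_bump x q y))).
  rewrite /= in_itv/= => /andP[tx _]; have x0 := lt_trans a0 tx.
  have := integrableZl measurableT x (integrable_bump q iv x0).
  by apply: eq_integrable => // y _; rewrite /= -EFinM mulrCA.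
pose G y := `|v y * (M * \1_(box s) y)|.
have M0 : 0 <= M by rewrite (le_trans _ (hM 1 0 ltr01)).
have iG : mu.-integrable setT (EFin \o G).
  suff ivM : mu.-integrable setT (EFin \o (fun y => v y * (M * \1_(box s) y))).
    exact: integrable_norm ivM.
  apply: (@integrable_mul_supp _ _ s M) => //.
  - by apply: measurable_funM => //; apply: measurable_indic; exact: measurable_box.
  - move=> x; rewrite normrM (ger0_norm M0) ler_piMr// indicE.
    by case: (_ \in _); rewrite ?normr1 ?normr0.
  - by move=> x nx; rewrite indicE memNset// mulr0.
have Gub x y : `]t / 2, t + 1[%classic x -> setT y ->
    `|partial1of2 (fun r y => v y * (r * plane_bump r q y)) x y| <= G y.
  rewrite /= in_itv/= => /andP[tx _] _; have x0 := lt_trans a0 tx.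
  rewrite partial1of2E; case: (dk x y) => _ ->.
  rewrite /G !normrM ler_wpM2l// (ger0_norm M0).
  have [yb|yb] := pselect (box s y).
    by rewrite indicE mem_set// normr1 mulr1 hM.
  rewrite (scale_deriv_out _ x0 _ s0 yb) ?normr0 ?mulr_ge0//.
  by apply: box_radius_bound => //; exact: ltW.
have D1 x y : `]t / 2, t + 1[%classic x -> setT y ->
    derivable ((fun r y => v y * (r * plane_bump r q y))^~ y) x 1.
  by move=> _ _; case: (dk x y).
apply: DeriveDef.
  apply: (derivable_under_integral measurableT It I1 D1 _ iG Gub) => y.
  exact: normr_ge0.
rewrite -derive1E (differentiation_under_integral measurableT It I1 D1 _ iG Gub).
  apply: eq_Rintegral => y _; rewrite partial1of2E.
  by case: (dk t y).
by move=> y; exact: normr_ge0.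
Qed.

(** The derivative of the average in t is the integral of v against
    - laplacian (plane_bump t 1), divided by 4 t.  This is the monotonicity of
    means of superharmonic functions, obtained without any integration by
    parts. *)
Lemma bump_average_ndecr (v : R2 -> R) : box_integrable v ->
  (forall t, 0 < t -> 0 <= \int[mu]_x (v x * - laplacian (plane_bump t 1) x)) ->
  forall s t, 0 < s -> s <= t ->
    bump_average v (flat_deriv 1) s <= bump_average v (flat_deriv 1) t.
Proof.
move=> iv vsup s t s0 st.
have dA r (r0 : 0 < r) := is_derive_bump_average (flat_deriv 1) iv r0.
apply: (@ger0_derive1_ndecry _ _ s) => // [r|r|].
- rewrite in_itv/= andbT => sr.
  by case: (dA r (lt_trans s0 sr)).
- rewrite in_itv/= andbT => sr; have r0 := lt_trans s0 sr.
  rewrite derive1E; case: (dA r r0) => _ ->.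
  have := vsup r r0.
  have -> : \int[mu]_x (v x * - laplacian (plane_bump r 1) x) =
      4 * r * \int[mu]_x (v x * scale_deriv r (flat_deriv 1) x).
    rewrite -RintegralZl//; last exact: integrable_scale_deriv.
    apply: eq_Rintegral => x _; rewrite laplacian_bump /scale_deriv; ring.
  by rewrite pmulr_rge0// mulr_gt0.
- apply: derivable_within_continuous => r; rewrite in_itv/= andbT => sr.
  by case: (dA r (lt_le_trans s0 sr)).
Qed.

End Superharmonic.


(** * Superharmonic functions do not tend to infinity *)

Section MinimumPrinciple.
Variable R : realType.
Local Notation R2 := (R * R)%type.
Local Notation T2 := (measurableTypeR R * measurableTypeR R)%type.
Local Notation mu := (@leb2 R).

Lemma leb2_square (a b : R) : a <= b ->
  mu (`[a, b] `*` `[a, b]) = ((b - a) ^+ 2)%:E.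
Proof.
move=> ab; have mI : measurable (`[a, b] : set (measurableTypeR R)) by [].
have E : (@lebesgue_measure R `[a, b] = (b - a)%:E)%classic.
  rewrite lebesgue_measure_itv/= lte_fin; case: ltP => [_|ba].
    by rewrite -EFinB.
  by rewrite (@le_anti _ _ a b) ?ab// subrr.
apply: etrans (product_measure1E _ _ mI mI) _.
by transitivity ((b - a)%:E * (b - a)%:E)%E; [congr (_ * _)%E|rewrite -EFinM].
Qed.

Lemma integrable_indic_square (a b c : R) : a <= b ->
  mu.-integrable setT (EFin \o (fun x => c * \1_(`[a, b] `*` `[a, b]) x)).
Proof.
move=> ab.
have mS : measurable (`[a, b] `*` `[a, b] : set T2) by exact: measurableX.
have iS : mu.-integrable setT (EFin \o (\1_(`[a, b] `*` `[a, b]))).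
  apply/integrableP; split; first exact/measurable_EFinP/measurable_indic.
  have -> : (\int[mu]_x `|(EFin \o \1_(`[a, b] `*` `[a, b])) x|)%E =
      (\int[mu]_x (\1_(`[a, b] `*` `[a, b] : set T2) x)%:E)%E.
    by apply: eq_integral => x _; rewrite /= ger0_norm.
  by rewrite integral_indic// setIT leb2_square// ltry.
have := integrableZl measurableT c iS.
by apply: eq_integrable.
Qed.

Lemma Rintegral_indic_square (a b c : R) : a <= b ->
  \int[mu]_x (c * \1_(`[a, b] `*` `[a, b]) x) = c * (b - a) ^+ 2.
Proof.
move=> ab.
have mS : measurable (`[a, b] `*` `[a, b] : set T2) by exact: measurableX.
rewrite RintegralZl//; last first.
  have := integrable_indic_square 1 ab.
  by apply: eq_integrable => // x _; rewrite /= mul1r.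
by rewrite /Rintegral integral_indic// setIT leb2_square.
Qed.

Lemma flat_deriv1_ge0 (r : R) : 0 <= flat (flat_deriv 1) r.
Proof.
rewrite /flat; case: ifP => // r0.
rewrite mulr_ge0 ?expR_ge0// /flat_deriv derivC subr0 mulr1 hornerXn.
exact: sqr_ge0.
Qed.

(** flat (flat_deriv 1) r is r^-2 exp(-1/r) for r > 0. *)
Lemma flat_deriv1_ge (r : R) : 2^-1 <= r -> r <= 1 ->
  expR (-2) <= flat (flat_deriv 1) r.
Proof.
move=> r2 r1; have r0 : 0 < r by rewrite (lt_le_trans _ r2)// invr_gt0.
rewrite /flat r0 /flat_deriv derivC subr0 mulr1 hornerXn.
have i1 : 1 <= r^-1 by rewrite invf_ge1.
have i2 : r^-1 <= 2 by rewrite -[leRHS]invrK lef_pV2 ?posrE// invr_gt0.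
rewrite -[leLHS]mul1r ler_pM ?expR_ge0//; first by rewrite exprn_ege1.
by rewrite ler_expR lerN2.
Qed.

(** The square [s/4, s/2]^2 lies outside the box and inside the half of the
    support where the bump is at least exp(-2); its area s^2/16 cancels the
    factor t = s^-2.  The box, where v may be negative, has fixed area and its
    contribution is of order s^-2. *)
Lemma bump_average_ge (v : R2 -> R) (L M B rho s : R) : box_integrable v ->
  0 <= L -> 0 <= M -> 0 <= rho -> 4 * rho < s ->
  (forall x, box rho x -> - M <= v x) ->
  (forall x, ~ box rho x -> L <= v x) ->
  (forall r, flat (flat_deriv 1) r <= B) ->
  L * expR (-2) / 16 - M * B * (2 * rho) ^+ 2 * s ^- 2 <=
    bump_average v (flat_deriv 1) (s ^- 2).
Proof.
move=> iv L0 M0 rho0 rs vin vout hB.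
have s0 : 0 < s by rewrite (le_lt_trans _ rs)// mulr_ge0.
have B0 : 0 <= B := le_trans (flat_deriv1_ge0 0) (hB 0).
set t := s ^- 2; have t0 : 0 < t by rewrite invr_gt0 exprn_gt0.
have ts : t * s ^+ 2 = 1 by rewrite mulVf// expf_neq0// gt_eqF.
have sle : s / 4 <= s / 2 by rewrite ler_pM2l// lef_pV2 ?posrE// ler_nat.
have rle : - rho <= rho by rewrite ge0_cp.
pose c1 := L * t * expR (-2); pose c2 := M * t * B.
have -> : L * expR (-2) / 16 - M * B * (2 * rho) ^+ 2 * t =
    \int[mu]_x (c1 * \1_(`[s / 4, s / 2] `*` `[s / 4, s / 2]) x
               - c2 * \1_(box rho) x).
  rewrite RintegralB//; try exact: integrable_indic_square.
  rewrite !Rintegral_indic_square//.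
  have -> : s / 2 - s / 4 = s / 4 by field.
  have -> : c1 * (s / 4) ^+ 2 = L * expR (-2) / 16 * (t * s ^+ 2).
    by rewrite /c1; field.
  by rewrite ts mulr1 /c2; congr (_ - _); ring.
apply: le_Rintegral => //.
- have i1 := integrable_indic_square c1 sle.
  have i2 := integrable_indic_square c2 rle.
  by have := integrableB measurableT i1 i2; apply: eq_integrable.
- have := integrableZl measurableT t (integrable_bump (flat_deriv 1) iv t0).
  by apply: eq_integrable => // y _; rewrite /= -EFinM mulrCA.
move=> x _; have bx0 : 0 <= t * plane_bump t (flat_deriv 1) x.
  by rewrite mulr_ge0 ?(ltW t0)//; exact: flat_deriv1_ge0.
have [xr|xr] := pselect (box rho x).
  rewrite (indicE _ (box rho)) mem_set// mulr1 indicE memNset ?mulr0 ?sub0r; last first.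
    move=> [/=]; rewrite in_itv/= => /andP[sx _] _.
    move: xr => [/=]; rewrite in_itv/= => /andP[_ xr] _.
    have : s / 4 <= rho := le_trans sx xr.
    by rewrite ler_pdivrMr// mulrC leNgt rs.
  apply: (@le_trans _ _ (- M * (t * plane_bump t (flat_deriv 1) x))).
    rewrite mulNr lerN2 /c2 -!mulrA ler_wpM2l// ler_wpM2l ?(ltW t0)//.
    exact: hB.
  by rewrite ler_wpM2r// vin.
rewrite (indicE _ (box rho)) memNset// mulr0 subr0 indicE.
apply: (@le_trans _ _ (L * (t * plane_bump t (flat_deriv 1) x))); last first.
  by rewrite ler_wpM2r// vout.
have [xQ|_] := boolP (x \in _); last by rewrite mulr0 mulr_ge0.
rewrite mulr1 /c1 -!mulrA ler_wpM2l// ler_wpM2l ?(ltW t0)//.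
move: xQ; rewrite inE => -[/=]; rewrite !in_itv/= => /andP[x1 x1'] /andP[x2 x2'].
have N2 : t * sqnorm x <= 2^-1.
  apply: (@le_trans _ _ (t * (s ^+ 2 / 2))); last by rewrite mulrA ts mul1r.
  rewrite ler_wpM2l ?(ltW t0)// /sqnorm.
  have := s0; nra.
apply: flat_deriv1_ge; first by lra.
by rewrite gerBl mulr_ge0 ?(ltW t0)// sqnorm_ge0.
Qed.

(** As t decreases to 0 the bump averages decrease by [bump_average_ndecr], yet
    exceed any bound by [bump_average_ge]. *)
Lemma superharmonic_not_coercive (v : R2 -> R) :
  continuous v -> box_integrable v ->
  (forall t, 0 < t -> 0 <= \int[mu]_x (v x * - laplacian (plane_bump t 1) x)) ->
  (forall L, exists rho, forall x, ~ box rho x -> L <= v x) -> False.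
Proof.
move=> cv iv vsup vinf; have mono := bump_average_ndecr iv vsup.
pose G1 := bump_average v (flat_deriv 1) 1.
(* chosen so that L * expR (-2) / 16 = `|G1| + 2 *)
pose L := 16 * expR 2 * (`|G1| + 2).
have L0 : 0 <= L by rewrite !mulr_ge0 ?expR_ge0// addr_ge0.
have [rho' hrho'] := vinf L.
pose rho := `|rho'|.
have hrho x : ~ box rho x -> L <= v x.
  move=> nx; apply: hrho' => -[/=]; rewrite !in_itv/= => x1 x2; apply: nx.
  have := ler_norm rho'; rewrite -/rho => rr.
  by split; rewrite /= in_itv/=; [move: x1|move: x2] => /andP[a b];
    apply/andP; split; lra.
have [x0 x0b hx0] : exists2 c, c \in box rho &
    forall x, x \in box rho -> v c <= v x.
  apply: compact_EVT_min.
  - by exists 0; split; rewrite /= in_itv/= oppr_le0 normr_ge0.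
  - exact: compact_box.
  - exact: continuous_subspaceT.
pose M := `|v x0|.
have vin x : box rho x -> - M <= v x.
  move=> bx; apply: le_trans (hx0 x (mem_set bx)).
  by rewrite lerNl /M -normrN ler_norm.
have [B hB] := flat_bounded (R := R) (flat_deriv 1).
have hB' r : flat (flat_deriv 1) r <= B := le_trans (ler_norm _) (hB r).
have B0 : 0 <= B := le_trans (flat_deriv1_ge0 0) (hB' 0).
pose K := M * B * (2 * rho) ^+ 2.
have M0 : 0 <= M := normr_ge0 _.
have K0 : 0 <= K by rewrite /K mulr_ge0 ?sqr_ge0// mulr_ge0.
(* beyond 4 * rho, and large enough for K * s ^- 2 <= 1 *)
pose s := 1 + 4 * rho + K.
have rho0 : 0 <= rho := normr_ge0 _.
have s1 : 1 <= s by rewrite /s; lra.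
have rs : 4 * rho < s by rewrite /s; lra.
have low := bump_average_ge iv L0 M0 rho0 rs vin hrho hB'.
have s20 : 0 < s ^+ 2 by rewrite exprn_gt0//; lra.
have s2 : s ^- 2 <= 1 by rewrite invf_le1// exprn_ege1.
have up := mono (s ^- 2) 1 _ s2.
have := le_trans low (up _); rewrite invr_gt0 s20 => /(_ isT).
have -> : L * expR (-2) / 16 = `|G1| + 2.
  rewrite /L expRN; field; exact: lt0r_neq0 (expR_gt0 2).
have Ks : K * s ^- 2 <= 1.
  rewrite ler_pdivrMr// mul1r (@le_trans _ _ s)//; first by rewrite /s; lra.
  by rewrite expr2 ler_peMr//; lra.
rewrite -/G1 -/K; have := ler_norm G1; lra.
Qed.

End MinimumPrinciple.


(** * Reduction of the system to one superharmonic function *)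

Section CartanRank.
Variables (F : fieldType) (g : lieAlgebra F).

(** In rank 0 the Cartan subalgebra is 0; being its own centralizer, it contains
    everything, and the algebra would be 0. *)
Lemma cartan_rank_gt0 n (A : 'M[int]_n) :
  simple_lie g -> cartan_matrix_of g A -> (0 < n)%N.
Proof.
move=> [[x [y xy0]] _] [h [al [t [[_ _ self_cent] [_ /size_basis dh _] _ _]]]].
case: n A al t dh => // A al t dh; exfalso.
have h0 : h = 0%VS.
  apply/eqP; rewrite -dimv_eq0; move: dh; rewrite dimvf => dh.
  have : (\dim h * 1 = 0)%N by exact: dh.
  by rewrite muln1 => ->.
have br0 (z : g) : lie_br z 0 = 0.
  by have := lie_brDr z (-1) 0 0; rewrite scaler0 addr0 scaleN1r addNr.
have all0 (z : g) : z = 0.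
  have : z \in h.
    by apply: self_cent => w; rewrite h0 memv0 => /eqP ->; exact: br0.
  by rewrite h0 memv0 => /eqP.
by rewrite [lie_br x y]all0 eqxx in xy0.
Qed.

End CartanRank.

Section TodaReduction.
Variable R : realType.
Local Notation R2 := (R * R)%type.
Local Notation mu := (@leb2 R).

(** Either the rows of A are dependent, or row combinations reach every vector,
    in particular the all-ones one. *)
Lemma exists_nonneg_combination n (A : 'M[int]_n) : (0 < n)%N ->
  exists c : 'I_n -> R,
    (exists i, c i != 0) /\ forall j, 0 <= \sum_(i < n) c i * (A i j)%:~R.
Proof.
move=> n0; pose B : 'M[R]_n := map_mx intr A.
suff [c c0 cB] : exists2 c : 'rV[R]_n, c != 0 & forall j, 0 <= (c *m B) 0 j.
  exists (c 0); split.
    apply: contrapT => nc; case/eqP: c0; apply/rowP => i; rewrite mxE.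
    by apply/eqP; apply: contrapT => /negP ci; apply: nc; exists i.
  move=> j; have := cB j; rewrite mxE.
  by under eq_bigr do rewrite mxE.
have [/eqP/det0P[c c0 cB]|dB] := eqVneq (\det B) 0.
  by exists c => // j; rewrite cB mxE.
have uB : B \in unitmx by rewrite unitmxE unitfE.
exists (const_mx 1 *m invmx B); last by move=> j; rewrite mulmxKV// mxE.
apply/eqP => /(congr1 (mulmx^~ B)); rewrite mulmxKV// mul0mx.
by move=> /rowP/(_ (Ordinal n0)); rewrite !mxE => /eqP; rewrite oner_eq0.
Qed.

Lemma integrable_lincomb n (c : 'I_n -> R) (h : 'I_n -> R2 -> R) D :
  measurable (D : set (measurableTypeR R * measurableTypeR R)) ->
  (forall i, mu.-integrable D (EFin \o h i)) ->
  mu.-integrable D (EFin \o (fun x => \sum_(i < n) c i * h i x)).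
Proof.
move=> mD ih.
have := integrable_sum mD (index_enum 'I_n) (P := xpredT)
  (fun i _ => integrableZl mD (c i) (ih i)).
by apply: eq_integrable => // x _; rewrite /= -sumEFin.
Qed.

Lemma Rintegral_lincomb n (c : 'I_n -> R) (h : 'I_n -> R2 -> R) :
  (forall i, mu.-integrable setT (EFin \o h i)) ->
  \int[mu]_x (\sum_(i < n) c i * h i x) = \sum_(i < n) c i * \int[mu]_x h i x.
Proof.
move=> ih; rewrite /Rintegral.
have -> : (\int[mu]_x (\sum_(i < n) c i * h i x)%:E =
    \int[mu]_x \sum_(i < n) (c i)%:E * (h i x)%:E)%E.
  by apply: eq_integral => x _; rewrite -sumEFin.
rewrite (integral_sum measurableT (fun i => integrableZl measurableT (c i) (ih i))).
rewrite -sum_fine.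
  apply: eq_bigr => i _.
  by rewrite -(@RintegralZl _ _ _ mu setT (h i) (c i)).
by move=> i _; apply: integrable_fin_num => //; exact: integrableZl.
Qed.

(** Since only the bumps are tested, the combination of the distributional
    equations is just linearity of the integral. *)
Lemma poisson_lincomb_superharmonic n (c : 'I_n -> R) (u f : 'I_n -> R2 -> R) :
  (forall i, poisson_distr (u i) (f i)) ->
  (forall x, 0 <= \sum_(i < n) c i * f i x) ->
  forall t, 0 < t ->
  0 <= \int[mu]_x ((\sum_(i < n) c i * u i x) * - laplacian (plane_bump t 1) x).
Proof.
move=> uf f0 t t0.
have -> : \int[mu]_x ((\sum_(i < n) c i * u i x) * - laplacian (plane_bump t 1) x) =
    \int[mu]_x (\sum_(i < n) c i * (u i x * - laplacian (plane_bump t 1) x)).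
  apply: eq_Rintegral => x _; rewrite mulr_suml.
  by apply: eq_bigr => i _; rewrite mulrA.
rewrite Rintegral_lincomb; last first.
  move=> i; case: (uf i) => /locally_integrable2_box iu _ _.
  have := integrableZl measurableT (4 * t)
    (integrable_scale_deriv (flat_deriv 1) iu t0).
  apply: eq_integrable => // x _; rewrite /= -EFinM laplacian_bump /scale_deriv.
  by congr EFin; ring.
under eq_bigr => i _.
  have [_ _ ->] := uf i; last exact: test_function_bump.
  over.
rewrite -Rintegral_lincomb; last first.
  move=> i; case: (uf i) => _ /locally_integrable2_box iu _.
  exact: integrable_bump.
apply: Rintegral_ge0 => x _.
under eq_bigr do rewrite mulrA.
rewrite -mulr_suml mulr_ge0// /plane_bump /flat.
by case: ifP => // _; rewrite hornerC mul1r expR_ge0.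
Qed.

(** The combination is the stated positive number times ln |x|, up to a bounded
    function. *)
Lemma toda_lincomb_coercive n m (p : 'I_m -> R2) (b : 'I_n -> 'I_m -> R)
    (u : 'I_n -> R2 -> R) (c : 'I_n -> R) :
  toda_asymptotics b u -> 0 < - \sum_(i < n) c i * beta_inf b i ->
  forall L, exists rho, forall x, ~ box rho x -> L <= \sum_(i < n) c i * u i x.
Proof.
move=> ua; set C := - _ => C0 L.
have [w hw] := choice ua.
have /choice[M hM] : forall i, exists Mi, forall x, 1 <= enorm x -> `|w i x| <= Mi.
  by move=> i; case: (hw i).
pose S := \sum_(i < n) `|c i| * M i.
pose s := `|L + S| / C.
have s0 : 0 <= s by rewrite divr_ge0// ltW.
exists (expR s) => x nx.
have rx : expR s <= enorm x.
  rewrite leNgt; apply/negP => xr; apply: nx.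
  have bd y : y ^+ 2 <= x.1 ^+ 2 + x.2 ^+ 2 -> y \in `[- expR s, expR s].
    move=> yx; rewrite in_itv/= -ler_norml -sqrtr_sqr (le_trans _ (ltW xr))//.
    by rewrite /enorm ler_wsqrtr.
  by split; apply: bd; rewrite ?lerDl ?lerDr ?sqr_ge0.
have x1 : 1 <= enorm x by apply: le_trans rx; rewrite -expR0 ler_expR.
have lnx : s <= ln (enorm x).
  by rewrite -[s]expRK ler_ln ?posrE ?expR_gt0// (lt_le_trans _ rx)// expR_gt0.
have -> : \sum_(i < n) c i * u i x =
    C * ln (enorm x) + \sum_(i < n) c i * w i x.
  rewrite /C mulNr mulr_suml -sumrN -big_split/=; apply: eq_bigr => i _.
  by case: (hw i) => _ _ ->//; ring.
have Sw : - S <= \sum_(i < n) c i * w i x.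
  rewrite /S -sumrN; apply: ler_sum => i _.
  rewrite lerNl (le_trans (ler_norm _))// normrN normrM ler_wpM2l//.
  exact: hM.
have Cs : L + S <= C * ln (enorm x).
  apply: (@le_trans _ _ (C * s)); last by rewrite ler_pM2l.
  by rewrite /s mulrC divfK ?gt_eqF// ler_norm.
by lra.
Qed.

End TodaReduction.

Theorem theorem1p2 (R : realType) (n : nat) (A : 'M[int]_n)
    (g : lieAlgebra R[i]) (hg : simple_lie g) (hA : cartan_matrix_of g A) :
  exists (m : nat) (p : 'I_m -> R * R) (b : 'I_n -> 'I_m -> R),
    [/\ (0 < m)%N,
        injective p,
        forall i l, 0 <= b i l < 1,
        forall i l,
          \sum_(s < m | s != l) b i s > \big[Num.max/0]_(k < n) b k l &
        ~ exists u : 'I_n -> R * R -> R,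
            toda_solution p b A u /\ toda_asymptotics b u].
Proof.
have n0 := cartan_rank_gt0 hg hA.
have [c [[i0 ci0] cA]] := @exists_nonneg_combination R n A n0.
(* With four points and b i l = beta i for all l, the growth exponent of u i is
   2 - 4 * beta i: it is -8/5 for beta i = 9/10 and 1/2 for beta i = 3/8, so its
   sign can be set against that of c i.  Since 3 * 3/8 > 9/10, the two values
   may be mixed. *)
pose beta i : R := if 0 <= c i then 9 / 10 else 3 / 8.
have betaP i : 3 / 8 <= beta i <= 9 / 10.
  by rewrite /beta; case: ifP => _; apply/andP; split; lra.
exists 4%N, (fun l => (l%:R, 0)), (fun i _ => beta i); split => //.
- by move=> l l' [/eqP]; rewrite eqr_nat => /eqP/val_inj.
- by move=> i _; have /andP[? ?] := betaP i; apply/andP; split; lra.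
- move=> i l; rewrite sumr_const cardC1 card_ord/= -mulr_natr.
  apply: bigmax_lt => [|k _]; have /andP[? ?] := betaP i; first by lra.
  by have /andP[? ?] := betaP k; lra.
move=> [u [sol asy]].
pose v x := \sum_(i < n) c i * u i x.
apply: (@superharmonic_not_coercive R v).
- move=> x; apply: cvg_big => [|i _]; first exact: add_continuous.
  by apply: cvgM; [exact: cvg_cst|case: (sol i) => /(_ x)].
- move=> s; apply: integrable_lincomb; first exact: measurable_box.
  by move=> i; case: (sol i) => _ [/locally_integrable2_box].
- apply: (poisson_lincomb_superharmonic (fun i => (sol i).2)) => x.
  under eq_bigr do rewrite mulr_sumr.
  rewrite exchange_big/= sumr_ge0// => j _.
  under eq_bigr do rewrite !mulrA.
  rewrite -!mulr_suml !mulr_ge0 ?expR_ge0//.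
  by apply: prodr_ge0 => l _; rewrite divr_ge0// powR_ge0.
- apply: (toda_lincomb_coercive (fun l => (l%:R, 0)) asy).
  have bE i : beta_inf (fun i (_ : 'I_4) => beta i) i = 2 - 4 * beta i.
    by rewrite /beta_inf sumr_const card_ord mulr_natl.
  rewrite -sumrN (bigD1 i0)//= ltr_pwDl//.
    rewrite bE /beta; case: ifP => c0; nra.
  apply: sumr_ge0 => i _; rewrite bE /beta; case: ifP => ci; nra.
Qed.
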